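(* Let $K$ be a field and $\lambda\in K$. (1) Let $(A,\mu,\Delta,\varepsilon,\alpha,\beta,\psi,\omega)$ be a counitary $\lambda$-infBH-bialgebra. Equip $A\otimes A$ with the BiHom-associative algebra structure $(A\otimes A,\cdot_{\varepsilon},\alpha\otimes\alpha,\beta\otimes\beta)$, where for $a,b,a',b'\in A$ $$(a\otimes b)\cdot_{\varepsilon}(a'\otimes b')=\varepsilon(b)\,aa'\otimes\beta(b')+\varepsilon(a')\,\alpha(a)\otimes bb'+\lambda\,\varepsilon(a')\varepsilon(b)\,\alpha(a)\otimes\beta(b').$$ Then $\Delta:(A,\mu,\alpha,\beta)\to(A\otimes A,\cdot_{\varepsilon},\alpha\otimes\alpha,\beta\otimes\beta)$ is a morphism of BiHom-associative algebras. (2) Let $(C,\mu,\Delta,1,\alpha,\beta,\psi,\omega)$ be a unitary $\lambda$-infBH-bialgebra. Equip $C\otimes C$ with the BiHom-coassociative coalgebra structure $(C\otimes C,\Delta_{\eta},\psi\otimes\psi,\omega\otimes\omega)$, where for $c,d\in C$ $$\Delta_{\eta}(c\otimes d)=(c_1\otimes 1)\otimes(c_2\otimes\psi(d))+(\omega(c)\otimes d_1)\otimes(1\otimes d_2)+\lambda(\omega(c)\otimes 1)\otimes(1\otimes\psi(d)).$$ Then $\mu:(C\otimes C,\Delta_{\eta},\psi\otimes\psi,\omega\otimes\omega)\to(C,\Delta,\psi,\omega)$ is a morphism of BiHom-coassociative coalgebras.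
   Context: All vector spaces and maps are over the field $K$; write $\Delta(c)=c_1\otimes c_2$ (Sweedler notation) and $ab=\mu(a\otimes b)$. A BiHom-associative algebra $(A,\mu,\alpha,\beta)$ consists of a vector space $A$ and linear maps $\mu:A\otimes A\to A$, $\alpha,\beta:A\to A$ with $\alpha\beta=\beta\alpha$, $\alpha(ab)=\alpha(a)\alpha(b)$, $\beta(ab)=\beta(a)\beta(b)$ and $\alpha(a)(bc)=(ab)\beta(c)$. It is unitary with unit $1\in A$ if $\alpha(1)=1=\beta(1)$, $a1=\alpha(a)$, $1a=\beta(a)$ for all $a$. A morphism of BiHom-associative algebras is a linear map commuting with multiplications and with the maps $\alpha$ and the maps $\beta$. A BiHom-coassociative coalgebra $(C,\Delta,\psi,\omega)$ consists of a vector space $C$ and linear maps $\Delta:C\to C\otimes C$, $\psi,\omega:C\to C$ with $\psi\omega=\omega\psi$, $(\psi\otimes\psi)\Delta=\Delta\psi$, $(\omega\otimes\omega)\Delta=\Delta\omega$ and $(\Delta\otimes\psi)\Delta=(\omega\otimes\Delta)\Delta$. It is counitary with counit $\varepsilon:C\to K$ if $\varepsilon\psi=\varepsilon$, $\varepsilon\omega=\varepsilon$, $(\mathrm{id}\otimes\varepsilon)\Delta=\omega$, $(\varepsilon\otimes\mathrm{id})\Delta=\psi$. A morphism of BiHom-coassociative coalgebras is a linear map $g$ commuting with the maps $\psi$ and the maps $\omega$, with $\Delta_D g=(g\otimes g)\Delta_C$. A $\lambda$-infBH-bialgebra $(A,\mu,\Delta,\alpha,\beta,\psi,\omega)$ is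 a BiHom-associative algebra $(A,\mu,\alpha,\beta)$ and a BiHom-coassociative coalgebra $(A,\Delta,\psi,\omega)$ such that $\alpha,\beta$ commute with $\psi,\omega$; $(\alpha\otimes\alpha)\Delta=\Delta\alpha$, $(\beta\otimes\beta)\Delta=\Delta\beta$; $\psi(ab)=\psi(a)\psi(b)$, $\omega(ab)=\omega(a)\omega(b)$; and $$\Delta(ab)=\omega(a)b_1\otimes\beta(b_2)+\alpha(a_1)\otimes a_2\psi(b)+\lambda\,\alpha\omega(a)\otimes\beta\psi(b).$$ It is a unitary $\lambda$-infBH-bialgebra if $(A,\mu,1,\alpha,\beta)$ is unitary and $\psi(1)=1=\omega(1)$; it is counitary if $(A,\Delta,\varepsilon,\psi,\omega)$ is counitary and $\varepsilon\alpha=\varepsilon=\varepsilon\beta$. *)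

(* Defs.v *)
From HB Require Import structures.
From mathcomp Require Import all_boot all_algebra.
From mathcomp Require Import freeg.
From mathcomp Require Import boolp.

Set Implicit Arguments.
Unset Strict Implicit.
Unset Printing Implicit Defensive.

Import GRing.Theory.
Local Open Scope ring_scope.
Local Open Scope quotient_scope.

(* Tensor product of arbitrary (possibly infinite-dimensional) K-modules: the
   quotient of the free K-module on U * V by the submodule [tens_rel] spanned
   by the bilinearity relations. *)
Section TensorProduct.
Variables (K : fieldType) (U V : lmodType K).

Notation F := {freeg (U * V)%type / K}.

Inductive tens_rel : F -> Prop :=
| Tens_rel0 : tens_rel 0
| Tens_relP a x y : tens_rel x -> tens_rel y -> tens_rel (a *: x + y)
| Tens_rell a u u' v :
    tens_rel (<< (a *: u + u', v) >> - (a *: << (u, v) >> + << (u', v) >>))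
| Tens_relr a u v v' :
    tens_rel (<< (u, a *: v + v') >> - (a *: << (u, v) >> + << (u, v') >>)).

Definition tens_relb (x : F) : bool := `[< tens_rel x >].

Lemma tens_relb_closed : zmod_closed tens_relb.
Proof.
split=> [|x y /asboolP hx /asboolP hy]; first exact/asboolP/Tens_rel0.
by apply/asboolP; rewrite addrC -scaleN1r; exact: Tens_relP.
Qed.

Definition tens_sub : zmodClosed F :=
  HB.pack tens_relb (GRing.isZmodClosed.Build F tens_relb tens_relb_closed).

Definition tensor : Type := Quotient.quot tens_sub.

HB.instance Definition _ := GRing.Zmodule.on tensor.

Definition tens_pi (x : F) : tensor := \pi_(Quotient.quot tens_sub) x.
Definition tens_repr (t : tensor) : F := repr (t : Quotient.quot tens_sub).

Lemma tens_reprK : cancel tens_repr tens_pi.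
Proof. by move=> t; exact: reprK. Qed.

Lemma tens_piP x y : tens_pi x = tens_pi y <-> tens_rel (x - y).
Proof.
rewrite /tens_pi; split=> [/eqP|h]; last apply/eqP.
  by rewrite -Quotient.idealrBE => /asboolP.
by rewrite -Quotient.idealrBE; exact/asboolP.
Qed.

Lemma tens_piD x y : tens_pi (x + y) = tens_pi x + tens_pi y.
Proof. exact: (raddfD (\pi_(Quotient.quot tens_sub))). Qed.

Definition tens_scale (a : K) (t : tensor) : tensor :=
  tens_pi (a *: tens_repr t).

Lemma tens_scale_pi a x : tens_scale a (tens_pi x) = tens_pi (a *: x).
Proof.
apply/tens_piP; rewrite -scalerBr -[_ *: _]addr0; apply: Tens_relP.
  by apply/tens_piP; rewrite tens_reprK.
exact: Tens_rel0.
Qed.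

Lemma tens_scaleA a b t : tens_scale a (tens_scale b t) = tens_scale (a * b) t.
Proof. by rewrite -[t]tens_reprK !tens_scale_pi scalerA. Qed.

Lemma tens_scale1 : left_id 1 tens_scale.
Proof. by move=> t; rewrite -[t]tens_reprK tens_scale_pi scale1r. Qed.

Lemma tens_scaleDr : right_distributive tens_scale +%R.
Proof.
move=> a t t'; rewrite -[t]tens_reprK -[t']tens_reprK.
by rewrite -tens_piD !tens_scale_pi scalerDr tens_piD.
Qed.

Lemma tens_scaleDl t : {morph tens_scale^~ t : a b / a + b}.
Proof.
move=> a b; rewrite -[t]tens_reprK !tens_scale_pi.
by rewrite scalerDl tens_piD.
Qed.

HB.instance Definition _ := GRing.Zmodule_isLmodule.Build K tensor
  tens_scaleA tens_scale1 tens_scaleDr tens_scaleDl.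

Definition tens (u : U) (v : V) : tensor := tens_pi << (u, v) >>.

Lemma tens_piZ a x : tens_pi (a *: x) = a *: tens_pi x.
Proof. by rewrite -tens_scale_pi. Qed.

Lemma tens_bilinear : bilinear_for *:%R *:%R tens.
Proof.
by split=> [v|u] a x y /=; rewrite -tens_piZ -tens_piD;
  apply/tens_piP; [exact: Tens_rell|exact: Tens_relr].
Qed.

HB.instance Definition _ :=
  bilinear_isBilinear.Build K U V tensor *:%R *:%R tens tens_bilinear.

(* [tlift f] is the linear map u (x) v |-> f u v induced by a bilinear f, see
   [tlift_tens]. It is total in [f], so that an expression g(c_1, c_2) in
   Sweedler notation is written [tlift (fun c1 c2 => g c1 c2) (Delta c)]; it is
   only meaningful when the function under it is bilinear. *)
Definition tlift (W : lmodType K) (f : U -> V -> W) (t : tensor) : W :=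
  fglift (fun p => f p.1 p.2) (tens_repr t).

Lemma fgliftD (W : lmodType K) (f : U * V -> W) x y :
  fglift f (x + y) = fglift f x + fglift f y.
Proof.
pose g := GRing.isZmodMorphism.Build _ _ (fglift f) (lift_is_additive f).
pose h : {additive _ -> _} := HB.pack (fglift f) g.
exact: (raddfD h).
Qed.

Lemma fgliftZ (W : lmodType K) (f : U * V -> W) a x :
  fglift f (a *: x) = a *: fglift f x.
Proof.
have lift0 : fglift f 0 = 0.
  by apply: (addrI (fglift f 0)); rewrite -fgliftD !addr0.
have liftS I r (G : I -> F) :
    fglift f (\sum_(i <- r) G i) = \sum_(i <- r) fglift f (G i).
  by elim: r => [|i r IHr]; rewrite ?big_nil ?big_cons // fgliftD IHr.
rewrite -[in RHS](freeg_sumE x) [a *: x]/(fgscale a x) /fgscale !liftS.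
by rewrite scaler_sumr; apply: eq_bigr => p _; rewrite !liftU scalerA.
Qed.

Lemma fgliftB (W : lmodType K) (f : U * V -> W) x y :
  fglift f (x - y) = fglift f x - fglift f y.
Proof. by rewrite -[- y]scaleN1r fgliftD fgliftZ scaleN1r. Qed.

Section Lift.
Variables (W : lmodType K) (f : U -> V -> W).
Hypothesis f_bilin : bilinear_for *:%R *:%R f.

Lemma tens_rel_lift x : tens_rel x -> fglift (fun p => f p.1 p.2) x = 0.
Proof.
elim=> [|a {}x y _ IHx _ IHy|a u u' v|a u v v'].
- by rewrite -[0](subrr 0) fgliftB subrr.
- by rewrite fgliftD fgliftZ IHx IHy scaler0 addr0.
- by rewrite fgliftB fgliftD fgliftZ !liftU /= !scale1r f_bilin.1 subrr.
- by rewrite fgliftB fgliftD fgliftZ !liftU /= !scale1r f_bilin.2 subrr.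
Qed.

Lemma tlift_pi x : tlift f (tens_pi x) = fglift (fun p => f p.1 p.2) x.
Proof.
apply/eqP; rewrite -subr_eq0 -fgliftB; apply/eqP/tens_rel_lift.
by apply/tens_piP; rewrite tens_reprK.
Qed.

Lemma tlift_tens u v : tlift f (tens u v) = f u v.
Proof. by rewrite tlift_pi liftU scale1r. Qed.

Lemma tlift_linear : linear (tlift f).
Proof.
move=> a x y; rewrite -[x]tens_reprK -[y]tens_reprK -tens_piZ -tens_piD.
by rewrite !tlift_pi fgliftD fgliftZ.
Qed.

End Lift.

Lemma tens_ind (P : tensor -> Prop) :
  P 0 -> (forall u v t, P t -> P (tens u v + t)) -> forall t, P t.
Proof.
move=> P0 PD t; rewrite -[t]tens_reprK -[tens_repr t]freeg_sumE.
elim: (dom _) => [|[u v] s IHs].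
  rewrite big_nil; suff -> : tens_pi 0 = 0 by [].
  by apply: (addrI (tens_pi 0)); rewrite -tens_piD !addr0.
rewrite big_cons tens_piD; set c := coeff _ _.
have -> : tens_pi << c *g (u, v) >> = tens (c *: u) v.
  rewrite [RHS](linearZl_LR tens v c u) -[RHS]tens_piZ; congr tens_pi.
  by apply/eqP/freeg_eqP => p; rewrite coeffZ !coeffU mul1r.
exact: PD.
Qed.

Lemma tens_linear_ext (W : lmodType K) (f g : {linear tensor -> W}) :
  (forall u v, f (tens u v) = g (tens u v)) -> f =1 g.
Proof.
move=> fg; elim/tens_ind => [|u v t IHt]; first by rewrite !linear0.
by rewrite !linearD fg IHt.
Qed.

Lemma tlift_lin_fun (W : lmodType K) a (f g : U -> V -> W) t :
  tlift (fun u v => a *: f u v + g u v) t = a *: tlift f t + tlift g t.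
Proof.
rewrite /tlift -[tens_repr t]Freeg_enum !fglift_Freeg /prelift.
rewrite scaler_sumr -big_split; apply: eq_bigr => p _ /=.
by rewrite scalerDr !scalerA mulrC.
Qed.

End TensorProduct.

Notation "U ⊗ V" := (tensor U V) (at level 40, left associativity).
Notation "u ⊗ₜ v" := (tens u v) (at level 40, left associativity).

Section TensorMaps.
Variables (K : fieldType).

Section Tmap.
Variables (U V U' V' : lmodType K).
Variables (f : {linear U -> U'}) (g : {linear V -> V'}).

Definition tmap : U ⊗ V -> U' ⊗ V' := tlift (fun u v => f u ⊗ₜ g v).

Fact tmap_bilinear : bilinear_for *:%R *:%R (fun u v => f u ⊗ₜ g v).
Proof. by split=> [v|u] a x y /=; rewrite linearP ?linearPl ?linearPr. Qed.

HB.instance Definition _ := GRing.isLinear.Build _ _ _ _ tmap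
    (tlift_linear tmap_bilinear).

Lemma tmapE u v : tmap (u ⊗ₜ v) = f u ⊗ₜ g v.
Proof. exact: (tlift_tens tmap_bilinear). Qed.

End Tmap.

(* The canonical identifications (U (x) V) (x) W = U (x) (V (x) W),
   U (x) K = U = K (x) U that are left implicit in coassociativity and in the
   counit axioms. *)
Section Assoc.
Variables (U V W : lmodType K).

Definition tassoc : (U ⊗ V) ⊗ W -> U ⊗ (V ⊗ W) :=
  tlift (fun x w => tlift (fun u v => u ⊗ₜ (v ⊗ₜ w)) x).

Fact tassoc_bilinear1 (w : W) :
  bilinear_for *:%R *:%R (fun (u : U) (v : V) => u ⊗ₜ (v ⊗ₜ w)).
Proof. by split=> [v|u] a x y /=; rewrite ?linearPl // linearPr. Qed.

Fact tassoc_bilinear : bilinear_for *:%R *:%R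
  (fun (x : U ⊗ V) (w : W) => tlift (fun u v => u ⊗ₜ (v ⊗ₜ w)) x).
Proof.
split=> [w|x] a y z /=; first exact: (tlift_linear (tassoc_bilinear1 w)).
rewrite -tlift_lin_fun; congr (tlift _ x).
by apply/funext => u; apply/funext => v; rewrite !linearPr.
Qed.

HB.instance Definition _ := GRing.isLinear.Build _ _ _ _ tassoc
  (tlift_linear tassoc_bilinear).

Lemma tassocE u v w : tassoc ((u ⊗ₜ v) ⊗ₜ w) = u ⊗ₜ (v ⊗ₜ w).
Proof.
rewrite /tassoc (tlift_tens tassoc_bilinear).
exact: (tlift_tens (tassoc_bilinear1 w)).
Qed.

End Assoc.

Section Unit.
Variable U : lmodType K.

Definition tunitr : U ⊗ K^o -> U := tlift (fun (u : U) (k : K^o) => (k : K) *: u).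
Definition tunitl : K^o ⊗ U -> U := tlift (fun (k : K^o) (u : U) => (k : K) *: u).

Fact tunitr_bilinear :
  bilinear_for *:%R *:%R (fun (u : U) (k : K^o) => (k : K) *: u).
Proof.
split=> [k|u] a x y /=; first by rewrite scalerDr !scalerA mulrC.
by rewrite scalerDl scalerA.
Qed.

Fact tunitl_bilinear :
  bilinear_for *:%R *:%R (fun (k : K^o) (u : U) => (k : K) *: u).
Proof.
split=> [u|k] a x y /=; first by rewrite scalerDl scalerA.
by rewrite scalerDr !scalerA mulrC.
Qed.

HB.instance Definition _ := GRing.isLinear.Build _ _ _ _ tunitr
    (tlift_linear tunitr_bilinear).
HB.instance Definition _ := GRing.isLinear.Build _ _ _ _ tunitl
    (tlift_linear tunitl_bilinear).

Lemma tunitrE u (k : K^o) : tunitr (u ⊗ₜ k) = (k : K) *: u.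
Proof. exact: (tlift_tens tunitr_bilinear). Qed.

Lemma tunitlE (k : K^o) u : tunitl (k ⊗ₜ u) = (k : K) *: u.
Proof. exact: (tlift_tens tunitl_bilinear). Qed.

End Unit.

End TensorMaps.

Section BiHom.
Variable K : fieldType.

(* Throughout, al, be, psi, om stand for the structure maps alpha, beta, psi,
   omega, e for the unit and eps for the counit. *)
Record BiHom_assoc (A : lmodType K) (mu : {linear A ⊗ A -> A})
    (al be : {linear A -> A}) : Prop := {
  bha_comm : forall a, al (be a) = be (al a);
  bha_al_mul : forall a b, al (mu (a ⊗ₜ b)) = mu (al a ⊗ₜ al b);
  bha_be_mul : forall a b, be (mu (a ⊗ₜ b)) = mu (be a ⊗ₜ be b);
  bha_assoc : forall a b c,
    mu (al a ⊗ₜ mu (b ⊗ₜ c)) = mu (mu (a ⊗ₜ b) ⊗ₜ be c)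
}.

Record BiHom_unit (A : lmodType K) (mu : {linear A ⊗ A -> A}) (e : A)
    (al be : {linear A -> A}) : Prop := {
  bhu_al : al e = e;
  bhu_be : be e = e;
  bhu_mulr : forall a, mu (a ⊗ₜ e) = al a;
  bhu_mull : forall a, mu (e ⊗ₜ a) = be a
}.

Record BiHom_assoc_morphism
    (A : lmodType K) (muA : {linear A ⊗ A -> A}) (alA beA : {linear A -> A})
    (B : lmodType K) (muB : {linear B ⊗ B -> B}) (alB beB : {linear B -> B})
    (f : {linear A -> B}) : Prop := {
  bham_mul : forall a b, f (muA (a ⊗ₜ b)) = muB (f a ⊗ₜ f b);
  bham_al : forall a, f (alA a) = alB (f a);
  bham_be : forall a, f (beA a) = beB (f a)
}.

Record BiHom_coassoc (C : lmodType K) (Delta : {linear C -> C ⊗ C})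
    (psi om : {linear C -> C}) : Prop := {
  bhc_comm : forall c, psi (om c) = om (psi c);
  bhc_psi : forall c, tmap psi psi (Delta c) = Delta (psi c);
  bhc_om : forall c, tmap om om (Delta c) = Delta (om c);
  bhc_coassoc : forall c,
    tassoc (tmap Delta psi (Delta c)) = tmap om Delta (Delta c)
}.

Record BiHom_counit (C : lmodType K) (Delta : {linear C -> C ⊗ C})
    (eps : {linear C -> K^o}) (psi om : {linear C -> C}) : Prop := {
  bhcu_psi : forall c, eps (psi c) = eps c;
  bhcu_om : forall c, eps (om c) = eps c;
  bhcu_r : forall c, tunitr (tmap idfun eps (Delta c)) = om c;
  bhcu_l : forall c, tunitl (tmap eps idfun (Delta c)) = psi c
}.

Record BiHom_coassoc_morphism
    (C : lmodType K) (DeltaC : {linear C -> C ⊗ C}) (psiC omC : {linear C -> C})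
    (D : lmodType K) (DeltaD : {linear D -> D ⊗ D}) (psiD omD : {linear D -> D})
    (g : {linear C -> D}) : Prop := {
  bhcm_psi : forall c, g (psiC c) = psiD (g c);
  bhcm_om : forall c, g (omC c) = omD (g c);
  bhcm_comul : forall c, DeltaD (g c) = tmap g g (DeltaC c)
}.

Record infBH_bialgebra (lam : K) (A : lmodType K) (mu : {linear A ⊗ A -> A})
    (Delta : {linear A -> A ⊗ A}) (al be psi om : {linear A -> A}) : Prop := {
  ibh_alg : BiHom_assoc mu al be;
  ibh_coalg : BiHom_coassoc Delta psi om;
  ibh_al_psi : forall a, al (psi a) = psi (al a);
  ibh_al_om : forall a, al (om a) = om (al a);
  ibh_be_psi : forall a, be (psi a) = psi (be a);
  ibh_be_om : forall a, be (om a) = om (be a);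
  ibh_al_comul : forall a, tmap al al (Delta a) = Delta (al a);
  ibh_be_comul : forall a, tmap be be (Delta a) = Delta (be a);
  ibh_psi_mul : forall a b, psi (mu (a ⊗ₜ b)) = mu (psi a ⊗ₜ psi b);
  ibh_om_mul : forall a b, om (mu (a ⊗ₜ b)) = mu (om a ⊗ₜ om b);
  ibh_comul_mul : forall a b,
    Delta (mu (a ⊗ₜ b)) =
      tlift (fun b1 b2 => mu (om a ⊗ₜ b1) ⊗ₜ be b2) (Delta b)
      + tlift (fun a1 a2 => al a1 ⊗ₜ mu (a2 ⊗ₜ psi b)) (Delta a)
      + lam *: (al (om a) ⊗ₜ be (psi b))
}.

Record unitary_infBH_bialgebra (lam : K) (A : lmodType K)
    (mu : {linear A ⊗ A -> A}) (Delta : {linear A -> A ⊗ A}) (e : A)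
    (al be psi om : {linear A -> A}) : Prop := {
  uibh_bialg : infBH_bialgebra lam mu Delta al be psi om;
  uibh_unit : BiHom_unit mu e al be;
  uibh_psi : psi e = e;
  uibh_om : om e = e
}.

Record counitary_infBH_bialgebra (lam : K) (A : lmodType K)
    (mu : {linear A ⊗ A -> A}) (Delta : {linear A -> A ⊗ A})
    (eps : {linear A -> K^o}) (al be psi om : {linear A -> A}) : Prop := {
  cibh_bialg : infBH_bialgebra lam mu Delta al be psi om;
  cibh_counit : BiHom_counit Delta eps psi om;
  cibh_al : forall a, eps (al a) = eps a;
  cibh_be : forall a, eps (be a) = eps a
}.

Section TensorAlgebra.
Variables (lam : K) (A : lmodType K) (mu : {linear A ⊗ A -> A}).
Variables (eps : {linear A -> K^o}) (al be : {linear A -> A}).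

(* [mul_eps a b a' b'] is the product of a (x) b and a' (x) b', see
   [mu_epsE]. *)
Definition mul_eps (a b a' b' : A) : A ⊗ A :=
  (eps b : K) *: (mu (a ⊗ₜ a') ⊗ₜ be b')
  + (eps a' : K) *: (al a ⊗ₜ mu (b ⊗ₜ b'))
  + (lam * (eps a' : K) * (eps b : K)) *: (al a ⊗ₜ be b').

Definition mu_eps : (A ⊗ A) ⊗ (A ⊗ A) -> A ⊗ A :=
  tlift (fun x y => tlift (fun a b => tlift (mul_eps a b) y) x).

Fact mul_eps_bilinearr a b : bilinear_for *:%R *:%R (mul_eps a b).
Proof.
split=> [b'|a'] k x y; rewrite /mul_eps /= !(linearP, linearPl, linearPr) /=.
  rewrite !scalerDr [RHS]addrACA; congr (_ + _).
    by rewrite [RHS]addrACA; congr (_ + _); rewrite scalerDl scalerA.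
  by rewrite mulrDr mulrDl scalerDl scalerA -[k *: _]/(k * _) !mulrA (mulrC k).
by rewrite !scalerDr [RHS]addrACA; congr (_ + _); rewrite addrACA.
Qed.

Fact mul_eps_bilinearl a' b' :
  bilinear_for *:%R *:%R (fun a b => mul_eps a b a' b').
Proof.
split=> [b|a] k x y; rewrite /mul_eps /= !(linearP, linearPl, linearPr) /=.
  by rewrite !scalerDr [RHS]addrACA; congr (_ + _); rewrite addrACA.
rewrite !scalerDr [RHS]addrACA; congr (_ + _).
  by rewrite [RHS]addrACA; congr (_ + _); rewrite scalerDl scalerA.
by rewrite mulrDr scalerDl scalerA -[k *: _]/(k * _) mulrCA.
Qed.

Fact mu_eps_bilinear : bilinear_for *:%R *:%R
  (fun x y => tlift (fun a b => tlift (mul_eps a b) y) x).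
Proof.
split=> [y|x] k t t' /=.
  apply: tlift_linear; split=> [b|a] c u v /=; rewrite -tlift_lin_fun;
    congr (tlift _ y); apply/funext => a'; apply/funext => b'.
    exact: (mul_eps_bilinearl a' b').1.
  exact: (mul_eps_bilinearl a' b').2.
rewrite -tlift_lin_fun; congr (tlift _ x).
apply/funext => a; apply/funext => b.
exact: (tlift_linear (mul_eps_bilinearr a b)).
Qed.

HB.instance Definition _ := GRing.isLinear.Build _ _ _ _ mu_eps
  (tlift_linear mu_eps_bilinear).

Lemma mu_epsE a b a' b' :
  mu_eps ((a ⊗ₜ b) ⊗ₜ (a' ⊗ₜ b')) = mul_eps a b a' b'.
Proof.
rewrite /mu_eps (tlift_tens mu_eps_bilinear) tlift_tens.
  exact: (tlift_tens (mul_eps_bilinearr a b)).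
split=> [{}b|{}a] c u v /=; rewrite -tlift_lin_fun;
  congr (tlift _ _); apply/funext => a1; apply/funext => b1.
  exact: (mul_eps_bilinearl a1 b1).1.
exact: (mul_eps_bilinearl a1 b1).2.
Qed.

End TensorAlgebra.

Section TensorCoalgebra.
Variables (lam : K) (C : lmodType K) (Delta : {linear C -> C ⊗ C}) (e : C).
Variables (psi om : {linear C -> C}).

Definition comul_eta (c d : C) : (C ⊗ C) ⊗ (C ⊗ C) :=
  tlift (fun c1 c2 => (c1 ⊗ₜ e) ⊗ₜ (c2 ⊗ₜ psi d)) (Delta c)
  + tlift (fun d1 d2 => (om c ⊗ₜ d1) ⊗ₜ (e ⊗ₜ d2)) (Delta d)
  + lam *: ((om c ⊗ₜ e) ⊗ₜ (e ⊗ₜ psi d)).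

Definition Delta_eta : C ⊗ C -> (C ⊗ C) ⊗ (C ⊗ C) := tlift comul_eta.

Fact comul_eta_bilinear : bilinear_for *:%R *:%R comul_eta.
Proof.
have bil d : bilinear_for *:%R *:%R
    (fun c1 c2 : C => (c1 ⊗ₜ e) ⊗ₜ (c2 ⊗ₜ psi d)).
  by split=> [v|u] k x y /=; rewrite !(linearPl, linearPr).
have bir c : bilinear_for *:%R *:%R
    (fun d1 d2 : C => (om c ⊗ₜ d1) ⊗ₜ (e ⊗ₜ d2)).
  by split=> [v|u] k x y /=; rewrite !(linearPl, linearPr).
split=> [d|c] k x y; rewrite /comul_eta /= !(linearP, linearPl, linearPr) /=.
  rewrite (tlift_linear (bil d)) !scalerDr [RHS]addrACA; congr (_ + _).
  rewrite [RHS]addrACA; congr (_ + _); rewrite -tlift_lin_fun.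
  congr (tlift _ _); apply/funext => d1; apply/funext => d2.
  by rewrite !(linearPl, linearPr).
rewrite (tlift_linear (bir c)) !scalerDr [RHS]addrACA; congr (_ + _).
rewrite [RHS]addrACA; congr (_ + _); rewrite -tlift_lin_fun.
congr (tlift _ _); apply/funext => c1; apply/funext => c2.
by rewrite !(linearPl, linearPr).
Qed.

HB.instance Definition _ := GRing.isLinear.Build _ _ _ _ Delta_eta
  (tlift_linear comul_eta_bilinear).

Lemma Delta_etaE c d : Delta_eta (c ⊗ₜ d) = comul_eta c d.
Proof. exact: (tlift_tens comul_eta_bilinear). Qed.

End TensorCoalgebra.
End BiHom.

(* Main.v *)
(* Part (1): applying the counit to Delta(ab) gives eps(ab) = -lambda eps(a)
   eps(b), which makes the terms of the two bracketings of a triple product that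
   do not match cancel. Contracting with eps turns the product of Delta(a) and
   Delta(b) into the compatibility condition for Delta(ab).
   Part (2) is dual: Delta(1 1) forces Delta(1) = -lambda 1 (x) 1, hence
   Delta_eta(c (x) 1) = (c_1 (x) 1) (x) (c_2 (x) 1) and
   Delta_eta(1 (x) d) = (1 (x) d_1) (x) (1 (x) d_2). *)

Require Import Defs.
From HB Require Import structures.
From mathcomp Require Import all_boot all_algebra.
From mathcomp Require Import ssrAC ring boolp.

Set Implicit Arguments.
Unset Strict Implicit.
Unset Printing Implicit Defensive.

Import GRing.Theory.
Local Open Scope ring_scope.

(** * Extensionality and functoriality for iterated tensor products *)

Section TensorLemmas.
Variable K : fieldType.

(** Packaged as linear maps, the partial applications let Sweedler sums be written as [tmap] of
    composites, to which extensionality on pure tensors applies. *)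
Definition tensR (U V : lmodType K) (v : V) : {linear U -> U ⊗ V} :=
  applyr (@tens K U V) v.
Definition tensL (U V : lmodType K) (u : U) : {linear V -> U ⊗ V} :=
  (@tens K U V : {bilinear U -> V -> U ⊗ V}) u.

Lemma tensDl (U V : lmodType K) (u u' : U) (v : V) :
  (u + u') ⊗ₜ v = u ⊗ₜ v + u' ⊗ₜ v.
Proof. by rewrite linearDl. Qed.

Lemma tensDr (U V : lmodType K) (u : U) (v v' : V) :
  u ⊗ₜ (v + v') = u ⊗ₜ v + u ⊗ₜ v'.
Proof. by rewrite linearDr. Qed.

Lemma tensZl (U V : lmodType K) k (u : U) (v : V) :
  (k *: u) ⊗ₜ v = k *: (u ⊗ₜ v).
Proof. by rewrite linearZl_LR. Qed.

Lemma tensZr (U V : lmodType K) k (u : U) (v : V) :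
  u ⊗ₜ (k *: v) = k *: (u ⊗ₜ v).
Proof. by rewrite linearZr_LR. Qed.

(** Fixing one factor with [tensL] or [tensR] leaves a linear map in the other, so [tens_linear_ext]
    can be applied again; the versions with more factors iterate this. *)
Lemma tens3_linear_ext (U V W X : lmodType K)
    (f g : {linear (U ⊗ V) ⊗ W -> X}) :
  (forall u v w, f (u ⊗ₜ v ⊗ₜ w) = g (u ⊗ₜ v ⊗ₜ w)) -> f =1 g.
Proof.
move=> fg; apply: tens_linear_ext => x w.
by apply: (tens_linear_ext (f := f \o tensR _ w) (g := g \o tensR _ w)) => u v;
  exact: fg.
Qed.

Lemma tens4_linear_ext (U U' V V' X : lmodType K)
    (f g : {linear (U ⊗ U') ⊗ (V ⊗ V') -> X}) :
  (forall u u' v v', f ((u ⊗ₜ u') ⊗ₜ (v ⊗ₜ v')) = g ((u ⊗ₜ u') ⊗ₜ (v ⊗ₜ v'))) ->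
  f =1 g.
Proof.
move=> fg; apply: tens3_linear_ext => u u' y.
by apply: (tens_linear_ext (f := f \o tensL _ (u ⊗ₜ u'))
  (g := g \o tensL _ (u ⊗ₜ u'))) => v v'; exact: fg.
Qed.

Lemma tens6_linear_ext (U U' V V' W W' X : lmodType K)
    (f g : {linear ((U ⊗ U') ⊗ (V ⊗ V')) ⊗ (W ⊗ W') -> X}) :
  (forall u u' v v' w w',
    f ((u ⊗ₜ u') ⊗ₜ (v ⊗ₜ v') ⊗ₜ (w ⊗ₜ w'))
    = g ((u ⊗ₜ u') ⊗ₜ (v ⊗ₜ v') ⊗ₜ (w ⊗ₜ w'))) -> f =1 g.
Proof.
move=> fg; apply: tens_linear_ext => x z.
apply: (tens4_linear_ext (f := f \o tensR _ z) (g := g \o tensR _ z)).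
move=> u u' v v' /=.
by apply: (tens_linear_ext (f := f \o tensL _ ((u ⊗ₜ u') ⊗ₜ (v ⊗ₜ v')))
  (g := g \o tensL _ ((u ⊗ₜ u') ⊗ₜ (v ⊗ₜ v')))) => w w'; exact: fg.
Qed.

Lemma eq_tmap (U V U1 V1 : lmodType K)
    (f f' : {linear U -> U1}) (g g' : {linear V -> V1}) :
  f =1 f' -> g =1 g' -> tmap f g =1 tmap f' g'.
Proof.
by move=> ff' gg'; apply: tens_linear_ext => u v /=; rewrite !tmapE ff' gg'.
Qed.

Lemma tmap_tmap (U V U1 V1 U2 V2 : lmodType K)
    (f1 : {linear U -> U1}) (g1 : {linear V -> V1})
    (f2 : {linear U1 -> U2}) (g2 : {linear V1 -> V2}) t :
  tmap f2 g2 (tmap f1 g1 t) = tmap (f2 \o f1) (g2 \o g1) t.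
Proof.
apply: (tens_linear_ext (f := tmap f2 g2 \o tmap f1 g1)) => u v.
by rewrite /= !tmapE.
Qed.

Lemma tassoc_tmap (U V W U1 V1 W1 : lmodType K) (f : {linear U -> U1})
    (g : {linear V -> V1}) (h : {linear W -> W1}) t :
  tassoc (tmap (tmap f g) h t) = tmap f (tmap g h) (tassoc t).
Proof.
apply: (tens3_linear_ext (f := tassoc (W := W1) \o tmap (tmap f g) h)
  (g := tmap f (tmap g h) \o tassoc (W := W))) => u v w.
by rewrite /= !(tmapE, tassocE) /= !tmapE tassocE.
Qed.

(* [tmapL g (v (x) w)] is the linear map u |-> (u (x) v) (x) g w. *)
Definition tmapL (U V W X : lmodType K) (g : {linear W -> X}) (t : V ⊗ W) :
  U -> (U ⊗ V) ⊗ X := fun u => tmap (tensL V u) g t.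

(** Here [u] sits inside the function being lifted, so linearity comes from that of [tlift] in its
    function argument. *)
Lemma tmapL_linear (U V W X : lmodType K) (g : {linear W -> X}) (t : V ⊗ W) :
  linear (tmapL (U := U) g t).
Proof.
move=> k u u'; rewrite /tmapL /tmap -tlift_lin_fun; congr tlift.
apply/funext => v; apply/funext => w.
by rewrite /= [(k *: u + u') ⊗ₜ v]linearPl linearPl.
Qed.

HB.instance Definition _ (U V W X : lmodType K) (g : {linear W -> X})
    (t : V ⊗ W) := GRing.isLinear.Build _ _ _ _ (tmapL (U := U) g t)
  (tmapL_linear g t).

End TensorLemmas.

(* Both bracketings of (a (x) b)(a' (x) b')(a'' (x) b'') once fully expanded,
   with l = lambda and x, y, z, t = eps b, eps b', eps a', eps a''; the vectors
   Q and X each occur on one side only and cancel there. *)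
Lemma mu_eps_assoc_terms (K : comRingType) (V : lmodType K) (l x y z t : K)
    (P Q R S T U W X : V) :
  y *: (x *: P + - (l * z * t) *: Q + (l * - (l * z * t) * x) *: R)
  + t *: (x *: S + z *: T + (l * z * x) *: U)
  + (l * t * y) *: (x *: W + z *: Q + (l * z * x) *: R)
  = x *: (y *: P + t *: S + (l * t * y) *: W)
  + z *: (- (l * x * y) *: X + t *: T + (l * t * - (l * x * y)) *: R)
  + (l * z * x) *: (y *: X + t *: U + (l * t * y) *: R).
Proof.
rewrite !scalerDr !scalerA !addrA.
(* Both sides take the order P, S, T, U, W, R, with the two R terms paired; last comes the
   cancelling pair, Q on the left and X on the right. *)
rewrite [LHS](ACl (1*4*5*6*7*(3*9)*(2*8))) [RHS](ACl (1*2*5*8*3*(6*9)*(4*7))).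
rewrite /= -!scalerDl.
have -> : y * - (l * z * t) + l * t * y * z = 0 by ring.
have -> : z * - (l * x * y) + l * z * x * y = 0 by ring.
rewrite !scale0r !addr0.
by congr (_ *: _ + _ *: _ + _ *: _ + _ *: _ + _ *: _ + _ *: _); ring.
Qed.

Lemma comul_mul_tmap (K : fieldType) (lam : K) (A : lmodType K)
    (mu : {linear A ⊗ A -> A}) (Delta : {linear A -> A ⊗ A})
    (al be psi om : {linear A -> A}) :
  infBH_bialgebra lam mu Delta al be psi om -> forall a b,
  Delta (mu (a ⊗ₜ b)) =
    tmap (mu \o tensL A (om a)) be (Delta b)
    + tmap al (mu \o tensR A (psi b)) (Delta a)
    + lam *: (al (om a) ⊗ₜ be (psi b)).
Proof. by move=> B a b; rewrite (ibh_comul_mul B). Qed.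

(** * The counitary case: the algebra structure on A ⊗ A *)

Section Counitary.
Variables (K : fieldType) (lam : K) (A : lmodType K) (mu : {linear A ⊗ A -> A}).
Variables (Delta : {linear A -> A ⊗ A}) (eps : {linear A -> K^o}).
Variables (al be psi om : {linear A -> A}).
Hypothesis H : counitary_infBH_bialgebra lam mu Delta eps al be psi om.

(** Under id ⊗ eps the first summand of Delta(ab) becomes om(a)om(b) = om(ab), which is already the
    whole value by the counit axiom. The other two summands therefore add up to 0, and applying eps
    once more gives eps(ab) + lambda eps(a) eps(b) = 0. *)
Lemma counit_mul a b : (eps (mu (a ⊗ₜ b)) : K) = - (lam * eps a * eps b).
Proof.
have [B [epsP epsO cr cl] epsA epsB] := H.
have unitr (f : {linear A -> A}) t :
    tunitr (tmap idfun eps (tmap f be t)) = f (tunitr (tmap idfun eps t)).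
  apply: (tens_linear_ext (f := tunitr (U := A) \o tmap idfun eps \o tmap f be)
    (g := f \o tunitr (U := A) \o tmap idfun eps)) => u v.
  by rewrite /= !tmapE !tunitrE /= linearZ_LR epsB.
(* Once both legs are evaluated by eps, the first may be contracted before the second; this brings
   in the left counit axiom. *)
have swap (h : {linear A -> A}) t :
    eps (tunitr (tmap idfun eps (tmap al h t)))
    = eps (h (tunitl (tmap eps idfun t))).
  apply: (tens_linear_ext
    (f := eps \o (tunitr (U := A) \o tmap idfun eps \o tmap al h))
    (g := eps \o (h \o tunitl (U := A) \o tmap eps idfun))) => u v.
  rewrite /= !tmapE tunitrE tunitlE /= !linearZ_LR epsA /=; exact: mulrC.
have := cr (mu (a ⊗ₜ b)).
rewrite (comul_mul_tmap B) !linearD /= unitr // cr /= (ibh_om_mul B).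
rewrite -addrA -[RHS]addr0 => /addrI /(congr1 eps).
rewrite linearD linear0 swap cl /= -(ibh_psi_mul B) epsP !linearZ_LR /=.
rewrite tmapE tunitrE linearZ_LR /= epsA epsO epsB epsP => /eqP.
rewrite addr_eq0 => /eqP ->; congr (- _).
by rewrite -mulrA; congr (_ * _); exact: mulrC.
Qed.

Lemma mu_eps_assoc x y z :
  mu_eps lam mu eps al be (tmap al al x ⊗ₜ mu_eps lam mu eps al be (y ⊗ₜ z))
  = mu_eps lam mu eps al be (mu_eps lam mu eps al be (x ⊗ₜ y) ⊗ₜ tmap be be z).
Proof.
have [B _ epsA epsB] := H.
have [com alM beM assoc] := ibh_alg B.
pose m : {linear _ -> _} := mu_eps lam mu eps al be.
pose f := m \o tmap (tmap al al) m \o tassoc (W := A ⊗ A).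
pose g := m \o tmap m (tmap be be).
suff: f =1 g by move/(_ (x ⊗ₜ y ⊗ₜ z)); rewrite /f /g /= tassocE !tmapE.
apply: tens6_linear_ext => a b a' b' a2 b2.
rewrite /f /g /= tassocE !tmapE /m /=.
rewrite !tmapE !mu_epsE /mul_eps !(tensDl, tensDr, tensZl, tensZr).
rewrite !linearD !linearZ_LR /= !mu_epsE /mul_eps.
(* Counits of products become scalars, and triple products are all bracketed to the right; what
   remains is an identity between scalar multiples of eight vectors. *)
rewrite !(epsA, epsB, counit_mul, alM, beM) -!assoc.
exact: mu_eps_assoc_terms.
Qed.

(** For s = Delta(a) and t = Delta(b) the counit axioms give u = om(a) and v = psi(b), and the
    right-hand side becomes the compatibility condition for Delta(ab). *)
Lemma mu_eps_tens s t :
  let u := tunitr (tmap idfun eps s) in let v := tunitl (tmap eps idfun t) in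
  mu_eps lam mu eps al be (s ⊗ₜ t) =
    tmap (mu \o tensL A u) be t + tmap al (mu \o tensR A v) s
    + lam *: (al u ⊗ₜ be v).
Proof.
move=> u v; rewrite {}/u.
(* Since [u] depends on [s], extensionality in [s] requires this summand to be visibly linear in
   [u]. *)
have -> u : tmap (mu \o tensL A u) be t = tmap mu idfun (tmapL be t u).
  by rewrite /tmapL tmap_tmap.
apply: (tens_linear_ext
  (f := mu_eps lam mu eps al be \o tensR _ t)
  (g := tmap mu idfun \o tmapL be t \o tunitr (U := A) \o tmap idfun eps
    \+ tmap al (mu \o tensR A v)
    \+ lam \*: (tensR A (be v) \o al \o tunitr (U := A)
                   \o tmap idfun eps))) => a b.
rewrite /= !tmapE tunitrE {}/v /=.
apply: (tens_linear_ext
  (f := mu_eps lam mu eps al be \o tensL _ (a ⊗ₜ b))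
  (g := tmap mu idfun \o tmap (tensL A (eps b *: a)) be
    \+ (tensL A (al a) \o mu \o tensL A b \o tunitl (U := A) \o tmap eps idfun)
    \+ lam \*: (tensL A (al (eps b *: a)) \o be \o tunitl (U := A)
                   \o tmap eps idfun))) => a' b'.
rewrite /= !tmapE tunitlE /= mu_epsE /mul_eps.
rewrite tensZl tensZr /= !linearZ_LR /= !(tensZl, tensZr) !scalerA.
by congr (_ + _ *: _); rewrite -mulrA; congr (_ * _); exact: mulrC.
Qed.

(** Taking [al] and [be] for [f] gives multiplicativity of the structure maps of A ⊗ A. *)
Lemma mu_eps_tmap (f : {linear A -> A}) :
  (forall a b, f (mu (a ⊗ₜ b)) = mu (f a ⊗ₜ f b)) ->
  (forall a, f (al a) = al (f a)) -> (forall a, f (be a) = be (f a)) ->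
  (forall a, eps (f a) = eps a) -> forall x y,
  tmap f f (mu_eps lam mu eps al be (x ⊗ₜ y))
  = mu_eps lam mu eps al be (tmap f f x ⊗ₜ tmap f f y).
Proof.
move=> fM fal fbe feps x y; pose m : {linear _ -> _} := mu_eps lam mu eps al be.
suff: tmap f f \o m =1 m \o tmap (tmap f f) (tmap f f).
  by move/(_ (x ⊗ₜ y)); rewrite /= tmapE.
apply: tens4_linear_ext => a b a' b'; rewrite /= !tmapE /= !tmapE !mu_epsE.
by rewrite /mul_eps !linearD !linearZ_LR /= !tmapE !fM !fal !fbe !feps.
Qed.

Lemma mu_eps_mul a b :
  Delta (mu (a ⊗ₜ b)) = mu_eps lam mu eps al be (Delta a ⊗ₜ Delta b).
Proof.
have [B [epsP epsO cr cl] epsA epsB] := H.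
by rewrite (comul_mul_tmap B) mu_eps_tens cr cl.
Qed.

End Counitary.

(** * The unitary case: the coalgebra structure on C ⊗ C *)

Section Unitary.
Variables (K : fieldType) (lam : K) (C : lmodType K) (mu : {linear C ⊗ C -> C}).
Variables (Delta : {linear C -> C ⊗ C}) (e : C).
Variables (al be psi om : {linear C -> C}).

Local Notation m := (Delta_eta lam Delta e psi om).

Lemma Delta_eta_tens c d :
  m (c ⊗ₜ d) = tmap (tensR _ e) (tensR _ (psi d)) (Delta c)
    + tmap (tensL _ (om c)) (tensL _ e) (Delta d)
    + lam *: ((om c ⊗ₜ e) ⊗ₜ (e ⊗ₜ psi d)).
Proof. by rewrite Delta_etaE. Qed.

(** Dual to [mu_eps_tmap], and used with [psi] and [om] for [f]. *)
Lemma Delta_eta_tmap (f : {linear C -> C}) :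
  (forall c, tmap f f (Delta c) = Delta (f c)) ->
  (forall c, f (psi c) = psi (f c)) -> (forall c, f (om c) = om (f c)) ->
  f e = e -> forall x,
  tmap (tmap f f) (tmap f f) (m x) = m (tmap f f x).
Proof.
move=> fD fpsi fom fe x.
apply: (tens_linear_ext (f := tmap (tmap f f) (tmap f f) \o m)
  (g := m \o tmap f f)) => c d.
rewrite /= tmapE !Delta_eta_tens !linearD linearZ_LR /= !tmapE /= !tmapE.
rewrite -!fD -!fpsi -!fom !fe !tmap_tmap; congr (_ + _ + _);
  by apply: eq_tmap => u /=; rewrite tmapE !(fe, fpsi, fom).
Qed.

Hypothesis H : unitary_infBH_bialgebra lam mu Delta e al be psi om.

(** Multiplication by 1 is alpha or beta, and these commute with Delta and fix 1. Hence each of the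
    first two summands of Delta(1 1) equals Delta(1), and cancelling one copy leaves the value of
    the other. *)
Lemma comul_unit : Delta e = - (lam *: (e ⊗ₜ e)).
Proof.
have [B [ale bee mr ml] psie ome] := H.
have El : tmap (mu \o tensL C e) be (Delta e) = Delta e.
  by rewrite -[in RHS]bee -(ibh_be_comul B); apply: eq_tmap => u /=.
have Er : tmap al (mu \o tensR C e) (Delta e) = Delta e.
  by rewrite -[in RHS]ale -(ibh_al_comul B); apply: eq_tmap => u /=.
have := comul_mul_tmap B e e; rewrite mr ale ome psie El Er ale bee.
by move/eqP; rewrite -addrA -[X in X == _]addr0 => /eqP/addrI/esym/eqP;
  rewrite addr_eq0 => /eqP.
Qed.

(** The units inserted by [Delta_eta] turn into alpha and beta under mu ⊗ mu, which yields the three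
    summands of the compatibility condition, the first two exchanged. *)
Lemma Delta_eta_mul x : Delta (mu x) = tmap mu mu (m x).
Proof.
have [B [ale bee mr ml] psie ome] := H.
apply: (tens_linear_ext (f := Delta \o mu) (g := tmap mu mu \o m)) => c d.
rewrite /= (comul_mul_tmap B) Delta_eta_tens !linearD linearZ_LR /= !tmapE.
rewrite !tmap_tmap mr ml [X in X + _ = _]addrC; congr (_ + _ + _).
  by apply: eq_tmap => u /=; rewrite ?mr.
by apply: eq_tmap => u /=; rewrite ?ml.
Qed.

(** By [comul_unit] the summand containing Delta(1) cancels the lambda term. *)
Lemma Delta_eta_unitr c : m (c ⊗ₜ e) = tmap (tensR _ e) (tensR _ e) (Delta c).
Proof.
have [_ _ psie ome] := H.
rewrite Delta_eta_tens comul_unit psie -addrA -[RHS]addr0; congr (_ + _).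
by rewrite linearN linearZ_LR /= tmapE addNr.
Qed.

Lemma Delta_eta_unitl d : m (e ⊗ₜ d) = tmap (tensL _ e) (tensL _ e) (Delta d).
Proof.
have [_ _ psie ome] := H.
rewrite Delta_eta_tens comul_unit ome addrAC -[RHS]add0r; congr (_ + _).
by rewrite linearN linearZ_LR /= tmapE addNr.
Qed.

(* [cross (u (x) v) (y (x) z)] is (u (x) 1) (x) ((v (x) y) (x) (1 (x) z)), the
   term involving both coproducts in either side of coassociativity. *)
Definition cross (s t : C ⊗ C) : (C ⊗ C) ⊗ ((C ⊗ C) ⊗ (C ⊗ C)) :=
  tmap (tensR _ e) (tmapL (tensL _ e) t) s.

Lemma cross_linear s : linear (cross s).
Proof.
move=> k t t'; rewrite /cross /tmap -tlift_lin_fun; congr tlift.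
by apply/funext => u; apply/funext => v; rewrite /= /tmapL linearP linearPr.
Qed.

HB.instance Definition _ s :=
  GRing.isLinear.Build _ _ _ _ (cross s) (cross_linear s).

(** For s = Delta(c) and y = psi(d) this is the right side of coassociativity on the first summand
    of Delta_eta(c ⊗ d), the one summand where the inner [Delta_eta] keeps all three terms. *)
Lemma Delta_eta_coassoc_r y s :
  tmap (tmap om om) m (tmap (tensR _ e) (tensR _ y) s)
  = tmap (tensR _ e) (tmap (tensR _ e) (tensR _ (psi y))) (tmap om Delta s)
    + cross (tmap om om s) (Delta y)
    + lam *: tassoc (tmap (tensR _ e) (tensR _ e) (tmap om om s)
                       ⊗ₜ (e ⊗ₜ psi y)).
Proof.
have [_ _ psie ome] := H.
pose f := tmap (tmap om om) m \o tmap (tensR C e) (tensR C y).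
pose g1 := tmap (tensR C e) (tmap (tensR C e) (tensR C (psi y)))
  \o tmap om Delta.
pose g2 := tmap (tensR C e) (tmapL (tensL C e) (Delta y)) \o tmap om om.
pose g3 := tassoc (U := C ⊗ C) (V := C ⊗ C) (W := C ⊗ C) \o tensR _ (e ⊗ₜ psi y)
  \o tmap (tensR _ e) (tensR _ e) \o tmap om om.
change (f s = (g1 \+ g2 \+ lam \*: g3) s).
apply: tens_linear_ext => u v; rewrite /f /g1 /g2 /g3.
rewrite /= !tmapE /= tassocE !tmapE Delta_eta_tens ome.
by rewrite !tensDr tensZr.
Qed.

(** For x = om(c) and t = Delta(d) this is the left side of coassociativity on the second summand of
    Delta_eta(c ⊗ d); its [cross] term is then the one produced by [Delta_eta_coassoc_r]. *)
Lemma Delta_eta_coassoc_l x t :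
  tassoc (tmap m (tmap psi psi) (tmap (tensL _ x) (tensL _ e) t))
  = cross (Delta x) (tmap psi psi t)
    + tmap (tensL _ (om x)) (tmap (tensL _ e) (tensL _ e))
        (tassoc (tmap Delta psi t))
    + lam *: ((om x ⊗ₜ e) ⊗ₜ tmap (tensL _ e) (tensL _ e) (tmap psi psi t)).
Proof.
have [_ _ psie ome] := H.
pose f := tassoc (U := C ⊗ C) (V := C ⊗ C) (W := C ⊗ C) \o tmap m (tmap psi psi)
  \o tmap (tensL C x) (tensL C e).
pose g1 := cross (Delta x) \o tmap psi psi.
pose g2 := tmap (tensL _ (om x)) (tmap (tensL C e) (tensL C e))
  \o tassoc (U := C) (V := C) (W := C) \o tmap Delta psi.
pose g3 := tensL (C ⊗ C ⊗ (C ⊗ C)) (om x ⊗ₜ e)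
  \o tmap (tensL C e) (tensL C e) \o tmap psi psi.
change (f t = (g1 \+ g2 \+ lam \*: g3) t).
apply: tens_linear_ext => y z; rewrite /f /g1 /g2 /g3.
rewrite /= !tmapE /= !tmapE Delta_eta_tens psie !tensDl tensZl !linearD.
rewrite linearZ_LR /= tassocE; congr (_ + _ + _).
  pose h := tassoc (U := C ⊗ C) (V := C ⊗ C) (W := C ⊗ C)
    \o tensR _ (e ⊗ₜ psi z) \o tmap (tensR C e) (tensR C (psi y)).
  pose k := tmap (tensR C e) (tmapL (U := C) (tensL C e) (psi y ⊗ₜ psi z)).
  (* Both sides are linear maps evaluated at [Delta x], so comparing them on pure tensors is
     enough. *)
  change (h (Delta x) = k (Delta x)); apply: tens_linear_ext => u v.
  by rewrite /h /k /= !tmapE /= tassocE /tmapL tmapE.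
pose h := tassoc (U := C ⊗ C) (V := C ⊗ C) (W := C ⊗ C)
  \o tensR _ (e ⊗ₜ psi z) \o tmap (tensL C (om x)) (tensL C e).
pose k := tmap (tensL _ (om x)) (tmap (tensL C e) (tensL C e))
  \o tassoc (U := C) (V := C) (W := C) \o tensR _ (psi z).
change (h (Delta y) = k (Delta y)); apply: tens_linear_ext => u v.
by rewrite /h /k /= !tmapE /= !tassocE tmapE /= tmapE.
Qed.

(** On each side one summand of [m] expands into three terms, while the other two meet the inner [m]
    only at c ⊗ 1 or 1 ⊗ d and give one term each; the resulting five terms match. *)
Lemma Delta_eta_coassoc x :
  tassoc (tmap m (tmap psi psi) (m x)) = tmap (tmap om om) m (m x).
Proof.
have [B _ psie ome] := H.
have [_ psiD omD coass] := ibh_coalg B.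
pose f := tassoc (U := C ⊗ C) (V := C ⊗ C) (W := C ⊗ C)
  \o tmap m (tmap psi psi) \o m.
apply: (tens_linear_ext (f := f) (g := tmap (tmap om om) m \o m)) => c d.
rewrite /f /= Delta_eta_tens !linearD !linearZ_LR /=.
rewrite Delta_eta_coassoc_l Delta_eta_coassoc_r !tmapE !psiD !omD !coass.
(* Only [Delta] acts on the factor c_1 ⊗ 1, so coassociativity of [Delta] applies beneath the
   inserted units. *)
have -> : tassoc (tmap m (tmap psi psi)
      (tmap (tensR _ e) (tensR _ (psi d)) (Delta c)))
    = tmap (tensR _ e) (tmap (tensR _ e) (tensR _ (psi (psi d))))
      (tmap om Delta (Delta c)).
  rewrite -coass -tassoc_tmap !tmap_tmap; congr tassoc.
  by apply: eq_tmap => u /=; rewrite ?Delta_eta_unitr ?tmapE.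
have -> : tmap (tmap om om) m (tmap (tensL _ (om c)) (tensL _ e) (Delta d))
    = tmap (tensL _ (om (om c))) (tmap (tensL _ e) (tensL _ e))
      (tmap om Delta (Delta d)).
  rewrite !tmap_tmap.
  by apply: eq_tmap => u /=; rewrite ?Delta_eta_unitl ?tmapE.
rewrite /= !tmapE Delta_eta_unitr Delta_eta_unitl psie ome !addrA.
(* The lambda summand of either side equals the lambda term of the expanded summand on the other
   side. *)
by rewrite [LHS](ACl (1*2*5*3*4)).
Qed.

End Unitary.

(** * Assembly of the two cases *)

Theorem theorem2p21 (K : fieldType) (lam : K) :
  (forall (A : lmodType K) (mu : {linear A ⊗ A -> A})
      (Delta : {linear A -> A ⊗ A}) (eps : {linear A -> K^o})
      (al be psi om : {linear A -> A}),
    counitary_infBH_bialgebra lam mu Delta eps al be psi om ->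
    BiHom_assoc (mu_eps lam mu eps al be) (tmap al al) (tmap be be)
    /\ BiHom_assoc_morphism mu al be
         (mu_eps lam mu eps al be) (tmap al al) (tmap be be) Delta)
  /\
  (forall (C : lmodType K) (mu : {linear C ⊗ C -> C})
      (Delta : {linear C -> C ⊗ C}) (e : C)
      (al be psi om : {linear C -> C}),
    unitary_infBH_bialgebra lam mu Delta e al be psi om ->
    BiHom_coassoc (Delta_eta lam Delta e psi om) (tmap psi psi) (tmap om om)
    /\ BiHom_coassoc_morphism
         (Delta_eta lam Delta e psi om) (tmap psi psi) (tmap om om)
         Delta psi om mu).
Proof.
split=> [A mu Delta eps al be psi om H|C mu Delta e al be psi om H].
  have [B cou epsA epsB] := H; have [com alM beM _] := ibh_alg B.
  split; split.
  - by move=> x /=; rewrite !tmap_tmap; apply: eq_tmap => a /=; rewrite com.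
  - exact: mu_eps_tmap.
  - exact: mu_eps_tmap.
  - exact: (mu_eps_assoc H).
  - exact: (mu_eps_mul H).
  - by move=> a; exact/esym/(ibh_al_comul B).
  - by move=> a; exact/esym/(ibh_be_comul B).
have [B un psie ome] := H; have [com psiD omD _] := ibh_coalg B.
split; split.
- by move=> x /=; rewrite !tmap_tmap; apply: eq_tmap => a /=; rewrite com.
- exact: Delta_eta_tmap.
- exact: Delta_eta_tmap.
- exact: (Delta_eta_coassoc H).
- move=> x; apply: (tens_linear_ext (f := mu \o tmap psi psi) (g := psi \o mu)).
  by move=> a b; rewrite /= tmapE (ibh_psi_mul B).
- move=> x; apply: (tens_linear_ext (f := mu \o tmap om om) (g := om \o mu)).
  by move=> a b; rewrite /= tmapE (ibh_om_mul B).
- exact: (Delta_eta_mul H).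
Qed.
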